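(* Let $X$ be a locally compact, non-compact Hausdorff space, with one-point compactification $\alpha X = X \cup \{\star\}$. (a) If $X$ is pseudoradial and $\alpha X$ is radial at $\star$, then every compactification of $X$ with countable remainder is pseudoradial. (b) If $X$ is sequential and $\alpha X$ is Fréchet-Urysohn at $\star$, then every compactification of $X$ with countable remainder is sequential.
   Context: A transfinite sequence is a net whose domain is (nonempty and) well-ordered. A space $Z$ is radial (respectively Fréchet-Urysohn) at $z$ if for every $A \subseteq Z$ with $z \in \overline{A}$ there is a transfinite sequence (respectively an $\omega$-indexed sequence) with range in $A$ converging to $z$. A space $Z$ is pseudoradial (respectively sequential) if for every non-closed $A \subseteq Z$ there is a transfinite sequence (respectively an $\omega$-indexed sequence) in $A$ converging to a point of $Z \setminus A$. A compactification of $X$ is a compact Hausdorff space $\gamma X$ containing $X$ as a dense subspace; its remainder is $\gamma X \setminus X$. $\star$ denotes the point at infinity of $\alpha X$. *)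

(* Defs.v *)
From mathcomp Require Import all_boot all_classical topology.
From mathcomp Require Import wochoice one_point_compactification.

Set Implicit Arguments.
Unset Strict Implicit.
Unset Printing Implicit Defensive.

Local Open Scope classical_set_scope.

(* The filter base of tails of a directed index set (I, R): a net x : I -> Z
   converges to z when x @ tails R --> z. *)
Definition tails (I : Type) (R : rel I) : set_system I :=
  filter_from [set: I] (fun i => [set j | R i j]).

(* wochoice.well_order R asks that every nonempty subset have a unique least
   element for the non-strict relation R; this makes R reflexive, antisymmetric,
   total and transitive, but allows I to be empty, whence inhabited I. *)
Definition transfinite_limit (Z : topologicalType) (A : set Z) (z : Z) : Prop :=
  exists (I : Type) (R : rel I) (x : I -> Z),
    [/\ inhabited I, well_order R, forall i, A (x i) & x @ tails R --> z].

Definition sequence_limit (Z : topologicalType) (A : set Z) (z : Z) : Prop :=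
  exists2 x : nat -> Z, (forall n, A (x n)) & x @ \oo --> z.

Definition radial_at (Z : topologicalType) (z : Z) : Prop :=
  forall A : set Z, closure A z -> transfinite_limit A z.

Definition frechet_urysohn_at (Z : topologicalType) (z : Z) : Prop :=
  forall A : set Z, closure A z -> sequence_limit A z.

Definition pseudoradial (Z : topologicalType) : Prop :=
  forall A : set Z, ~ closed A -> exists2 z, (~` A) z & transfinite_limit A z.

Definition sequential (Z : topologicalType) : Prop :=
  forall A : set Z, ~ closed A -> exists2 z, (~` A) z & sequence_limit A z.

Definition topological_embedding (X Y : topologicalType) (e : X -> Y) : Prop :=
  [/\ injective e, continuous e &
      forall U : set X, open U -> exists2 V : set Y, open V & e @^-1` V = U].

(* A compactification of X is given by a compact Hausdorff space gX together
   with an embedding e : X -> gX identifying X with a dense subspace of gX. *)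
Definition compactification (X gX : topologicalType) (e : X -> gX) : Prop :=
  [/\ compact [set: gX], hausdorff_space gX, topological_embedding e &
      dense (range e)].

Definition remainder (X gX : topologicalType) (e : X -> gX) : set gX :=
  ~` range e.

(* The point at infinity of the one-point compactification, whose carrier is
   option X. *)
Definition star (X : topologicalType) : one_point_compactification X := None.

(* Main.v *)
(** Both parts are instances of one argument. Let [N] be the remainder and let
    [A] be a non-closed subset of [gX] whose traces on [X] and on [N] are closed
    (if the trace on [X] is not closed, use the hypothesis on [X]; if the one on
    [N] is not, use that every point of [N] is a G_delta in the compact space
    [N]). Pick [p] in [closure A] outside [A] and an open [O] containing [p]
    whose closure misses the intersection of [A] and [N]. Then [p], which lies
    in [N], is adherent to [B], the intersection of [A], [O] and [X], so no
    compact subset of [X] contains [B]; hence some generalised sequence in [B]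
    converges to the point at infinity of the one-point compactification. Its
    set [C] of cluster points in [gX] is a nonempty closed subset of [N], so a
    countable compact space, and has an isolated point [c]. Restricting to the
    cofinal set of indices at which the sequence is in a small neighbourhood of
    [c] leaves [c] as the only cluster point, hence as the limit. *)

Require Import Defs.
From mathcomp Require Import all_boot all_classical topology.
From mathcomp Require Import one_point_compactification.
From mathcomp Require Import wochoice.

Set Implicit Arguments.
Unset Strict Implicit.
Unset Printing Implicit Defensive.

Local Open Scope classical_set_scope.

(** * Well-orders and their filters of tails *)

Lemma well_order_total (I : Type) (R : rel I) : well_order R -> total R.
Proof.
move=> wR i j.
have [|k [[/asboolP[]-> lb _]]] := wR (fun k => `[< k = i \/ k = j >]).
- by exists i; apply/asboolP; left.
- by rewrite (lb j)//; apply/asboolP; right.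
- by rewrite (lb i) ?orbT//; apply/asboolP; left.
Qed.

(** Both elements are least in the pair they form, and least elements are unique. *)
Lemma well_order_antisym (I : Type) (R : rel I) : well_order R -> antisymmetric R.
Proof.
move=> wR i j /andP[Rij Rji].
have Rxx k : R k k by have /orP[] := well_order_total wR k k.
have [|k [_ uk]] := wR (fun k => `[< k = i \/ k = j >]).
  by exists i; apply/asboolP; left.
rewrite -(uk i) ?(uk j)//; split; try (by apply/asboolP; tauto);
  by move=> l /asboolP[]->.
Qed.

Lemma well_order_trans (I : Type) (R : rel I) : well_order R -> transitive R.
Proof.
move=> wR j i k Rij Rjk; have asR := well_order_antisym wR.
have [|m [[/asboolP mE lb _]]] :=
  wR (fun m => `[< [\/ m = i, m = j | m = k] >]).
  by exists i; apply/asboolP; constructor 1.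
have Rmi : R m i by apply: lb; apply/asboolP; constructor 1.
have Rmj : R m j by apply: lb; apply/asboolP; constructor 2.
have Rmk : R m k by apply: lb; apply/asboolP; constructor 3.
case: mE => mE; subst m => //.
- by rewrite (asR i j)// Rij Rmi.
- by rewrite -(asR j k)// Rjk Rmj.
Qed.

Lemma well_order_sub (I : Type) (R : rel I) (S : set I) :
  well_order R -> well_order (fun i j : {i | S i} => R (sval i) (sval j)).
Proof.
move=> wR A [[i Si] Ai].
have [|k [[/asboolP[Sk Ak] lb] uk]] :=
  wR (fun i => `[< exists Si : S i, exist _ i Si \in A >]).
  by exists i; apply/asboolP; exists Si.
exists (exist _ k Sk); split.
  by split=> // -[j Sj] Aj /=; apply: lb; apply/asboolP; exists Sj.
move=> [j Sj] [Aj lbj]; apply: eq_exist; apply: uk; split.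
  by apply/asboolP; exists Sj.
by move=> l /asboolP[Sl Al]; exact: (lbj (exist _ l Sl)).
Qed.

Lemma leq_well_order : well_order leq.
Proof.
apply/(antisymmetric_well_order anti_leq) => A exA.
by exists (ex_minn exA); case: ex_minnP.
Qed.

Lemma tails_proper (I : Type) (R : rel I) :
  inhabited I -> well_order R -> ProperFilter (tails R).
Proof.
move=> [i0] wR; have Rtot := well_order_total wR.
have Rxx k : R k k by have /orP[] := Rtot k k.
apply: filter_from_proper; last by move=> i _; exists i; exact: Rxx.
apply: filter_fromT_filter; first by exists i0.
move=> i j; have Rtr := well_order_trans wR.
have /orP[Rij|Rji] := Rtot i j.
  by exists j => k /= Rjk; split => //; exact: Rtr Rjk.
by exists i => k /= Rik; split => //; exact: Rtr Rik.
Qed.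

(** * Families of generalised sequences *)

(* D is thought of as the family of filters of tails of the index sets allowed
   for generalised sequences. The last condition says that these can be
   restricted to a cofinal set S of indices. *)
Definition admissible (D : forall I : Type, set_system I -> Prop) : Prop :=
  [/\ forall I F, D I F -> ProperFilter F, D nat \oo &
      forall I F (S : set I), D I F ->
        (forall P, F P -> P `&` S !=set0) ->
        exists (J : Type) (G : set_system J) (j : J -> I),
          [/\ D J G, forall k, S (j k) & j @ G --> within S F]].

Definition limit (D : forall I : Type, set_system I -> Prop)
    (Z : topologicalType) (A : set Z) (z : Z) : Prop :=
  exists (I : Type) (F : set_system I) (x : I -> Z),
    [/\ D I F, forall i, A (x i) & x @ F --> z].

Definition wo_tails (I : Type) (F : set_system I) : Prop :=
  exists R : rel I, [/\ inhabited I, well_order R & F = tails R].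

(** An indexed family, so that case analysis replaces [I] by [nat] and the filter by [\oo] at once,
    with no transport along an equality of types. *)
Inductive nat_tails : forall I : Type, set_system I -> Prop :=
  NatTails : nat_tails \oo.

Lemma wo_tails_admissible : admissible wo_tails.
Proof.
split=> [I F [R [I0 wR ->]]||I F S [R [I0 wR ->]] FS].
- exact: tails_proper.
- by exists leq; split; [constructor; exact: 0%N|exact: leq_well_order|].
have tailR i : tails R [set k | R i k] by exists i.
have [i0] := I0; have [k0 [_ Sk0]] := FS _ (tailR i0).
exists {i | S i}, (tails (fun i j : {i | S i} => R (sval i) (sval j))), sval.
split.
- eexists; split; last reflexivity; last exact: well_order_sub.
  by constructor; exists k0.
- by move=> [].
move=> P [i _ iP]; have [k [/= Rik Sk]] := FS _ (tailR i).
exists (exist _ k Sk) => // -[l Sl] /= Rkl; apply: iP => //=.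
exact: well_order_trans Rkl.
Qed.

Lemma nat_tails_admissible : admissible nat_tails.
Proof.
split=> [I F []||I F S DF]; [exact: _|by []|case: DF S => S FS].
(* [j] need not be increasing: [n <= j n] already makes it tend to infinity. *)
have /choice[j jP] n : exists k, (n <= k)%N /\ S k.
  by have [|k []] := FS [set k | (n <= k)%N]; [exists n|exists k].
exists nat, \oo, j; split=> [//|k|P [n _ nP]]; first by case: (jP k).
exists n => // k /= nk; have [kj Sj] := jP k.
by apply: nP => //=; exact: leq_trans kj.
Qed.

Lemma limit_wo_tails (Z : topologicalType) (A : set Z) z :
  limit wo_tails A z <-> transfinite_limit A z.
Proof.
split=> [[I [F [x [[R [I0 wR ->]] Ax xz]]]]|[I [R [x [I0 wR Ax xz]]]]].
  by exists I, R, x.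
by exists I, (tails R), x; split=> //; exists R.
Qed.

Lemma limit_nat_tails (Z : topologicalType) (A : set Z) z :
  limit nat_tails A z <-> sequence_limit A z.
Proof.
split=> [[I [F [x [DF]]]]|[x Ax xz]]; last by exists nat, \oo, x.
by case: DF x => x Ax xz; exists x.
Qed.

(** * Compact Hausdorff spaces and their countable closed subsets *)

Lemma compact_cvg_cluster (K : topologicalType) (F : set_system K) (x : K) :
  hausdorff_space K -> compact [set: K] -> ProperFilter F ->
  cluster F `<=` [set x] -> F --> x.
Proof.
move=> K2 Kc FF Fx; apply: (compact_cluster_set1 K2 Kc _ FF) => //;
  try exact: filterT.
rewrite eqEsubset; split=> // _ ->.
have [y [_ Fy]] := Kc F FF filterT.
by rewrite -(Fx y Fy).
Qed.

Lemma compact_open_closure (K : topologicalType) (x : K) (U : set K) :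
  hausdorff_space K -> compact [set: K] -> nbhs x U ->
  exists O, [/\ open O, O x & closure O `<=` U].
Proof.
move=> K2 Kc xU; have [|V xV VU] := compact_regular K2 Kc _ xU.
  exact: filterT.
move: xV; rewrite nbhsE => -[O [oO Ox] OV]; exists O; split=> //.
exact: subset_trans (closureS OV) VU.
Qed.

(* A countable Baire category argument: otherwise shrinking open sets could
   avoid the points of C one after the other. *)
Lemma countable_isolated_point (K : topologicalType) (C : set K) :
  hausdorff_space K -> compact [set: K] -> closed C -> countable C -> C !=set0 ->
  exists c U, [/\ C c, open U, U c & C `&` closure U `<=` [set c]].
Proof.
move=> K2 Kc clC /countable_injP[f finj] [c0 Cc0].
apply: contrapT => noiso.
pose good U := open U /\ C `&` U !=set0.
have /choice[step stepP] (nU : nat * set K) : exists U', good nU.2 ->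
    [/\ good U', closure U' `<=` nU.2 &
        forall c, C c -> f c = nU.1 -> ~ closure U' c].
  case: nU => n U /=; have [gU|] := pselect (good U); last by exists set0.
  have [oU [c [Cc Uc]]] := gU.
  have [d [Cd Ud fd]] : exists d, [/\ C d, U d & f d <> n].
    have [fc|] := pselect (f c = n); last by exists c.
    (* If [c] itself has number [n], another point of [C] in [U] is needed; without one, [c] and [O]
       would witness that [c] is isolated. *)
    have [O [oO Oc OU]] :=
      compact_open_closure K2 Kc (open_nbhs_nbhs (conj oU Uc)).
    apply: contrapT => nod; apply: noiso; exists c, O; split=> // d [Cd Od].
    apply: contrapT => dc; apply: nod; exists d; split=> //; first exact: OU.
    by rewrite -fc => /finj fdc; apply: dc; apply: fdc; rewrite inE.
  have dV : nbhs d (U `&` ~` [set e | C e /\ f e = n]).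
    apply: filterI; first exact: open_nbhs_nbhs.
    have [[e [Ce fe]]|noe] := pselect (exists e, C e /\ f e = n).
      apply: (@filterS _ _ _ (~` [set e])).
        move=> e' /= e'e [Ce' fe']; apply: e'e; apply: finj; rewrite ?inE//.
        by rewrite fe fe'.
      apply: open_nbhs_nbhs; split.
        exact/closed_openC/accessible_closed_set1/hausdorff_accessible.
      by move=> /= de; apply: fd; rewrite de.
    by apply: filterE => e Ce; apply: noe; exists e.
  have [O [oO Od OV]] := compact_open_closure K2 Kc dV.
  exists O => _; split; [by split=> //; exists d|by move=> y /OV[]|].
  by move=> y Cy fy /OV[_]; apply.
pose U := fix U n := if n is m.+1 then step (m, U m) else [set: K].
have Ugood n : good (U n).
  elim: n => [|n /(stepP (n, U n))[]//].
  by split; [exact: openT|exists c0].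
have UP n := stepP (n, U n) (Ugood n).
have Udecr m n : (m <= n)%N -> U n `<=` U m.
  elim: n => [|n IH]; first by rewrite leqn0 => /eqP->.
  rewrite leq_eqVlt => /orP[/eqP->//|/IH Unm].
  apply: subset_trans Unm; have [_ sU _] := UP n.
  exact: subset_trans (@subset_closure _ _) sU.
pose F := filter_from [set: nat] (fun n => C `&` U n).
have FF : ProperFilter F.
  apply: filter_from_proper; last by move=> n _; case: (Ugood n).
  apply: filter_fromT_filter; first by exists 0%N.
  move=> i j; exists (maxn i j) => x [Cx Ux].
  by split; split=> //; apply: Udecr Ux; rewrite (leq_maxl, leq_maxr).
have [p [_]] := Kc F FF filterT; rewrite clusterE => Fp.
have Cp : C p by rewrite (closure_id C).1//; apply: Fp; exists 0%N => // x [].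
(* The closure of [U (f p).+1] was built to miss the point of [C] numbered [f p], which is [p]. *)
have [_ _ /(_ p Cp erefl)] := UP (f p); apply.
by apply: Fp; exists (f p).+1 => // x [].
Qed.

(** The neighbourhoods [O n] separate [q] from the other points of [N] one at a time. A sequence in
    [B] that eventually stays in each of them has its cluster points in the closed set [N], hence
    only at [q]. *)
Lemma countable_sequence_limit (K : topologicalType) (N B : set K) (q : K) :
  hausdorff_space K -> compact [set: K] -> closed N -> countable N -> B `<=` N ->
  closure B q -> sequence_limit B q.
Proof.
move=> K2 Kc clN /countable_injP[f finj] BN Bq.
have /choice[O OP] n : exists O, nbhs q O /\
    forall e, N e -> f e = n -> e <> q -> ~ closure O e.
  have [[e [Ne fe eq]]|noe] := pselect (exists e, [/\ N e, f e = n & e <> q]).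
    have qe : nbhs q (~` [set e]).
      apply: open_nbhs_nbhs; split; last by move=> /= qe; apply: eq.
      exact/closed_openC/accessible_closed_set1/hausdorff_accessible.
    have [O [oO Oq Oe]] := compact_open_closure K2 Kc qe.
    exists O; split; first exact: open_nbhs_nbhs.
    move=> e' Ne' fe' e'q /Oe; apply => /=.
    by apply: finj; rewrite ?inE// fe fe'.
  exists setT; split; first exact: filterT.
  by move=> e Ne fe eq; case: noe; exists e.
pose V := fix V n := if n is m.+1 then V m `&` O m else [set: K].
have qV n : nbhs q (V n).
  elim: n => [|n IH]; first exact: filterT.
  by apply: filterI => //; case: (OP n).
have Vdecr m n : (m <= n)%N -> V n `<=` V m.
  elim: n => [|n IH]; first by rewrite leqn0 => /eqP->.
  rewrite leq_eqVlt => /orP[/eqP->//|/IH Vnm] x [? _]; exact: Vnm.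
have /choice[a aP] n : exists a, B a /\ V n a by exact: Bq.
exists a => [n|]; first by case: (aP n).
apply: compact_cvg_cluster => // p; rewrite clusterE => ap.
have Np : N p.
  rewrite (closure_id N).1//; apply: ap; exists 0%N => // n _ /=.
  by apply: BN; case: (aP n).
apply: contrapT => pq; have [_ /(_ p Np erefl pq)] := OP (f p); apply.
apply: ap; exists (f p).+1 => // n /= fpn; have [_ Vn] := aP n.
by have [] := Vdecr _ _ fpn _ Vn.
Qed.

(** * Compactifications with countable remainder *)

Lemma compactification_nbhs (X gX : topologicalType) (e : X -> gX) (x : X)
    (V : set X) :
  compactification e -> compact V -> nbhs x V -> nbhs (e x) (e @` V).
Proof.
move=> [_ g2 [einj ec eo] de] Vc; rewrite nbhsE => -[U [oU Ux] UV].
have [O oO OU] := eo U oU.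
have eVcl : closed (e @` V).
  apply: compact_closed => //; apply: continuous_compact => //.
  exact: continuous_subspaceT.
rewrite nbhsE; exists O; first by split=> //; rewrite -[O _]/((e @^-1` O) x) OU.
(* The image of [V] is closed, so adherence of [y] suffices: density gives a point of the range in
   [O] near [y], and the trace of [O] on [X] is [U], inside [V]. *)
move=> y Oy; rewrite (closure_id (e @` V)).1//.
move=> W; rewrite nbhsE => -[W' [oW' W'y] W'W].
have [|w [[Ow W'w] [z _ ez]]] := de (O `&` W') _ (openI oO oW').
  by exists y.
exists w; split; last exact: W'W.
by exists z => //; apply: UV; rewrite -OU /= ez.
Qed.

Lemma compactification_limit (D : forall I : Type, set_system I -> Prop)
    (X gX : topologicalType) (e : X -> gX) :
  admissible D -> locally_compact [set: X] ->
  (forall A : set X, ~ closed A -> exists2 z, (~` A) z & limit D A z) ->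
  (forall A : set (one_point_compactification X),
     closure A (star X) -> limit D A (star X)) ->
  compactification e -> countable (remainder e) ->
  forall A : set gX, ~ closed A -> exists2 z, (~` A) z & limit D A z.
Proof.
move=> [Dproper Dnat Drefine] Xlc XD starD cg cN A nclA.
have [gc g2 [einj ec eo] de] := cg.
have Xnbhs (x : X) : exists V : set X, [/\ nbhs x V, compact V & closed V].
  have [V] := Xlc x I; rewrite withinET => xV [Vc Vcl].
  by exists V.
have range_nbhs (x : X) : nbhs (e x) (range e).
  have [V [xV Vc _]] := Xnbhs x.
  apply: filterS (compactification_nbhs cg Vc xV) => _ [y _ <-].
  by exists y.
have clN : closed (remainder e).
  by apply: open_closedC; rewrite openE => _ [x _ <-]; exact: range_nbhs.
have [clX|nclX] := pselect (closed (e @^-1` A)); last first.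
  have [z Az [I [F [x [DF Ax xz]]]]] := XD _ nclX.
  exists (e z) => //; exists I, F, (e \o x); split=> //.
  apply: cvg_comp xz _; exact: ec.
have [clAN|nclAN] := pselect (closed (A `&` remainder e)); last first.
  have [q qcl nAq] : exists2 q, closure (A `&` remainder e) q &
      ~ (A `&` remainder e) q.
    apply: contrapT => noq; apply: nclAN => q qcl.
    by apply: contrapT => nq; apply: noq; exists q.
  have Nq : remainder e q.
    by rewrite (closure_id (remainder e)).1//; apply: closureS qcl => ? [].
  exists q; first by move=> Aq; apply: nAq.
  have [|a Aa aq] := @countable_sequence_limit _ _ (A `&` remainder e) q
    g2 gc clN cN _ qcl; first by move=> ? [].
  by exists nat, \oo, a; split=> // n; case: (Aa n).
have [p pcl nAp] : exists2 p, closure A p & ~ A p.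
  apply: contrapT => nop; apply: nclA => p pcl.
  by apply: contrapT => np; apply: nop; exists p.
have Np : remainder e p.
  (* The range is open, so a point [e x] adherent to [A] is adherent to the part of [A] in the
     range; then [x] lies in the closed trace of [A]. *)
  move=> [x _ ex]; apply: nAp; rewrite -ex; apply: clX => U.
  rewrite nbhsE => -[U' [oU' U'x] U'U].
  have [O oO OU] := eo U' oU'.
  have Op : nbhs p O.
    apply: open_nbhs_nbhs; split=> //; rewrite -ex.
    by rewrite -[O _]/((e @^-1` O) x) OU.
  have rp : nbhs p (range e) by rewrite -ex; exact: range_nbhs.
  have [z [Az [[y _ ez] Oz]]] := pcl _ (filterI rp Op).
  by exists y; split; [rewrite /= ez|apply: U'U; rewrite -OU /= ez].
(* The limit found below lies in the remainder and in [closure O], so this choice keeps it out of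
   [A]. *)
have [O [oO Op OAN]] : exists O, [/\ open O, O p &
    closure O `<=` ~` (A `&` remainder e)].
  apply: compact_open_closure => //; apply: open_nbhs_nbhs; split.
    exact: closed_openC.
  by move=> -[].
pose B := e @^-1` (A `&` O).
have Bstar : closure (Some @` B : set (one_point_compactification X)) (star X).
  (* A neighbourhood of infinity missing [B] would put [B] inside a compact [V], whose image is
     closed and would then contain [p]. *)
  move=> T /= [V [Vc Vcl] VT]; apply: contrapT => noB.
  have BV : B `<=` V.
    move=> b Bb; apply: contrapT => nVb; apply: noB; exists (Some b).
    by split; [exists b|apply: VT; left; exists b].
  have eVcl : closed (e @` V).
    apply: compact_closed => //; apply: continuous_compact => //.
    exact: continuous_subspaceT.
  have [x _ ex] : (e @` V) p; last by apply: Np; exists x.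
  apply: eVcl => W pW.
  have [y [Ay [[Wy Oy] nNy]]] : A `&` ((W `&` O) `&` ~` (A `&` remainder e)) !=set0.
    apply: pcl; apply: filterI.
      by apply: filterI => //; exact: open_nbhs_nbhs.
    by apply: open_nbhs_nbhs; split; [exact: closed_openC|case].
  have [[b _ eb]|nry] := pselect (range e y); last by case: nNy.
  exists y; split=> //; exists b => //.
  by apply: BV; rewrite /B /= eb.
have [I [F [x [DF Bx xstar]]]] := starD _ Bstar.
have FF := Dproper _ _ DF.
have /choice[b bP] i : exists b, B b /\ Some b = x i.
  by have [b] := Bx i; exists b.
pose C := cluster (e \o b @ F).
have imF P : F P -> (e \o b @ F) ((e \o b) @` P).
  by apply: (@filterS _ F) => i Pi; exists i.
have CN : C `<=` remainder e.
  (* The sequence tends to infinity, so it eventually leaves each compact neighbourhood [V] of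
     [y]. *)
  move=> p' + [y _ ey]; rewrite -ey => Cy; have [V [yV Vc Vcl]] := Xnbhs y.
  have FV : F (fun i => ~ V (b i)).
    have : nbhs (star X) (Some @` (~` V) `|` [set None]) by exists V.
    move=> /xstar FV; apply: (@filterS _ F _ (x @^-1` _) _ _ FV) => i /=; have [_ <-] := bP i.
    by case=> [[z nVz [<-]]|].
  have [||w [[i nVi <-] [z Vz /einj zb]]] :=
    Cy ((e \o b) @` [set i | ~ V (b i)]) (e @` V).
  - exact: imF.
  - exact: compactification_nbhs.
  - by apply: nVi; rewrite -zb.
have CO : C `<=` closure O.
  move=> y; rewrite /C clusterE; apply.
  by apply: (@filterE _ F) => i /=; have [[]] := bP i.
have [|||c [U [Cc oU Uc CU]]] := countable_isolated_point g2 gc _ _ _ (C := C).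
- by rewrite /C clusterE; apply: closed_bigI => ? _; exact: closed_closure.
- exact: sub_countable (subset_card_le CN) cN.
- by have [y [_ Cy]] := gc (e \o b @ F) _ filterT; exists y.
(* The indices with values in [U] are cofinal because [c] is a cluster point. *)
have [|J [G [j [DG Sj jG]]]] := Drefine _ _ [set i | U (e (b i))] DF.
  move=> P FP; have [||w [[i Pi <-] Ui]] := Cc ((e \o b) @` P) U.
  - exact: imF.
  - exact: open_nbhs_nbhs.
  - by exists i.
have GG := Dproper _ _ DG.
exists c; first by move=> Ac; apply: (OAN c (CO c Cc)); split=> //; exact: CN.
exists J, G, (e \o b \o j); split=> // [k|]; first by have [[]] := bP (j k).
(* A cluster point of the restricted sequence lies in [C] and in [closure U], so it equals [c]. *)
apply: compact_cvg_cluster => // q qcl; apply: CU; split.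
  apply: cvg_cluster qcl => P FP.
  by apply: (jG ((e \o b) @^-1` P)); apply: (@filterS _ F _ _ _ _ FP).
by move: qcl; rewrite clusterE; apply; apply: (@filterE _ G) => k; exact: Sj.
Qed.

Unset Implicit Arguments.

Theorem theorem3p7 (X : topologicalType)
  (X_lc : locally_compact [set: X]) (X_ncpt : ~ compact [set: X])
  (X_T2 : hausdorff_space X) :
  (pseudoradial X -> radial_at (star X) ->
     forall (gX : topologicalType) (e : X -> gX),
       compactification e -> countable (remainder e) -> pseudoradial gX)
  /\
  (sequential X -> frechet_urysohn_at (star X) ->
     forall (gX : topologicalType) (e : X -> gX),
       compactification e -> countable (remainder e) -> sequential gX).
Proof.
split=> XD starD gX e cg cN A nclA.
- have [||z Az /limit_wo_tails zA] :=
    compactification_limit wo_tails_admissible X_lc _ _ cg cN nclA.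
  + by move=> B /XD[z Bz /limit_wo_tails zB]; exists z.
  + by move=> B /starD/limit_wo_tails.
  + by exists z.
- have [||z Az /limit_nat_tails zA] :=
    compactification_limit nat_tails_admissible X_lc _ _ cg cN nclA.
  + by move=> B /XD[z Bz /limit_nat_tails zB]; exists z.
  + by move=> B /starD/limit_nat_tails.
  + by exists z.
Qed.
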